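(* Let $A$ be a commutative ring with identity and let $M$ be an $A$-module. Let $\mathrm{Exal}(A,M)$ be the category of square-zero extensions of $A$ by $M$, let $M\text{-}\mathrm{Tors}$ be the category of $M$-torsors in $\mathrm{Rings}/A$, and let $\Psi:\mathrm{Exal}(A,M)\to M\text{-}\mathrm{Tors}$ be the functor which sends a square-zero extension $(f:B\to A,\alpha_f)$ to the $M$-torsor $(f,\tau_f)$ with $\tau_f((f(b),m),b)=\alpha_f(m)+b$, and which sends each morphism of square-zero extensions to itself, regarded as a morphism of $M$-torsors. Then $\Psi$ is an equivalence of categories.
   Context: All rings are commutative with identity; ring homomorphisms preserve the identity. $\mathrm{Rings}/A$ is the category of rings over $A$ (objects: ring homomorphisms $f:B\to A$; morphisms: ring homomorphisms commuting with the maps to $A$). For $f:B\to A$ in $\mathrm{Rings}/A$, $f_*M$ is $M$ regarded as a $B$-module via $b\cdot m=f(b)m$. A *square-zero extension* of $A$ by $M$ is an object $f:B\to A$ of $\mathrm{Rings}/A$ with $f$ surjective and $(\ker f)^2=0$, together with an isomorphism $\alpha_f:f_*M\to\ker(f)$ of $B$-modules. A *morphism of square-zero extensions* from $f:B\to A$ to $g:C\to A$ is a morphism $h:f\to g$ in $\mathrm{Rings}/A$ with $h(\alpha_f(m))=\alpha_g(m)$ for all $m\in M$. $A\oplus M$ is the ring with the direct sum additive group and multiplication $(a_1,m_1)(a_2,m_2)=(a_1a_2,a_1m_2+a_2m_1)$; $\pi_A:A\oplus M\to A$ is the projection. For $f:B\to A$ and $g:C\to A$, $B\times_A C=\{(b,c)\in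 B\times C: f(b)=g(c)\}$, and $f\times g:B\times_A C\to A$ is $(b,c)\mapsto f(b)=g(c)$. An *$M$-torsor* is an object $f:B\to A$ of $\mathrm{Rings}/A$ with $f$ surjective, together with a morphism $\tau_f:\pi_A\times f\to f$ in $\mathrm{Rings}/A$ (i.e. a ring homomorphism $\tau_f:(A\oplus M)\times_A B\to B$ over $A$) such that, writing $\tau_f(m,b)$ for $\tau_f((f(b),m),b)$: (i) $\tau_f(0,b)=b$ for all $b\in B$; (ii) for each $(b_1,b_2)\in B\times_A B$ there is a unique $m\in M$ with $\tau_f(m,b_2)=b_1$. A *morphism of $M$-torsors* from $f:B\to A$ to $g:C\to A$ is a morphism $h:f\to g$ in $\mathrm{Rings}/A$ with $h(\tau_f(m,b))=\tau_g(m,h(b))$ for all $m\in M$, $b\in B$. *)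

(* Defs.v *)
From HB Require Import structures.
From mathcomp Require Import all_boot all_algebra.
From mathcomp Require Import boolp.

Set Implicit Arguments.
Unset Strict Implicit.
Unset Printing Implicit Defensive.

Import GRing.Theory.
Local Open Scope ring_scope.

Record category := Category {
  obj :> Type;
  hom : obj -> obj -> Type;
  idc : forall X, hom X X;
  (* diagrammatic order: [compc u v] is "first u, then v" *)
  compc : forall X Y Z, hom X Y -> hom Y Z -> hom X Z;
  comp1c : forall X Y (u : hom X Y), compc (idc X) u = u;
  compc1 : forall X Y (u : hom X Y), compc u (idc Y) = u;
  compcA : forall X Y Z W (u : hom X Y) (v : hom Y Z) (w : hom Z W),
    compc u (compc v w) = compc (compc u v) w }.
Arguments hom {c} _ _.
Arguments idc {c} _.

Record functor (C D : category) := Functor {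
  fobj :> C -> D;
  fhom : forall X Y, hom X Y -> hom (fobj X) (fobj Y);
  fhom_id : forall X, fhom (idc X) = idc (fobj X);
  fhom_comp : forall X Y Z (u : hom X Y) (v : hom Y Z),
    fhom (compc u v) = compc (fhom u) (fhom v) }.
Arguments fhom {C D} f {X Y} _.

Definition id_functor (C : category) : functor C C :=
  @Functor C C id (fun X Y u => u) (fun=> erefl) (fun _ _ _ _ _ => erefl).

Section CompFunctor.
Variables (C D E : category) (F : functor C D) (G : functor D E).

Fact comp_fhom_id X : fhom G (fhom F (idc X)) = idc (G (F X)).
Proof. by rewrite !fhom_id. Qed.

Fact comp_fhom_comp X Y Z (u : hom X Y) (v : hom Y Z) :
  fhom G (fhom F (compc u v)) = compc (fhom G (fhom F u)) (fhom G (fhom F v)).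
Proof. by rewrite !fhom_comp. Qed.

(* first F, then G *)
Definition comp_functor : functor C E :=
  @Functor C E (fun X => G (F X)) (fun X Y u => fhom G (fhom F u))
    comp_fhom_id comp_fhom_comp.
End CompFunctor.

Record nat_iso (C D : category) (F G : functor C D) := NatIso {
  ni_fun : forall X, hom (F X) (G X);
  ni_inv : forall X, hom (G X) (F X);
  ni_funK : forall X, compc (ni_fun X) (ni_inv X) = idc (F X);
  ni_invK : forall X, compc (ni_inv X) (ni_fun X) = idc (G X);
  ni_natural : forall X Y (u : hom X Y),
    compc (fhom F u) (ni_fun Y) = compc (ni_fun X) (fhom G u) }.

Definition is_equivalence (C D : category) (F : functor C D) : Prop :=
  exists G : functor D C,
    inhabited (nat_iso (comp_functor F G) (id_functor C)) /\
    inhabited (nat_iso (comp_functor G F) (id_functor D)).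

(* [comPzRingType], not [comNzRingType]: the zero ring is allowed. *)
Lemma rmorphism_eq (B C : comPzRingType) (u v : {rmorphism B -> C}) :
  u =1 v -> u = v.
Proof.
case: u v => [u [[hu1] [hu2] ]] [v [[hv1] [hv2] ]] /= /funext uv; subst v.
by rewrite (Prop_irrelevance hu1 hv1) (Prop_irrelevance hu2 hv2).
Qed.

Record ring_over (A : comPzRingType) := RingOver {
  total :> comPzRingType;
  proj : {rmorphism total -> A} }.

Record over_hom (A : comPzRingType) (S T : ring_over A) := OverHom {
  over_fun :> {rmorphism S -> T};
  over_homE : forall b, proj T (over_fun b) = proj S b }.

Section RingsOver.
Variable A : comPzRingType.
Implicit Types S T U V : ring_over A.

Lemma over_hom_eq S T (u v : over_hom S T) : u =1 v -> u = v.
Proof.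
case: u v => [u hu] [v hv] /= /rmorphism_eq uv; subst v.
by rewrite (Prop_irrelevance hu hv).
Qed.

Definition over_id S : over_hom S S :=
  @OverHom A S S idfun (fun=> erefl).

Fact over_comp_subproof S T U (u : over_hom S T) (v : over_hom T U) b :
  proj U ((v \o u) b) = proj S b.
Proof. by rewrite /= !over_homE. Qed.

Definition over_comp S T U (u : over_hom S T) (v : over_hom T U) :
    over_hom S U :=
  @OverHom A S U (v \o u) (over_comp_subproof u v).

Fact over_comp1 S T (u : over_hom S T) : over_comp (over_id S) u = u.
Proof. exact: over_hom_eq. Qed.

Fact over_comp1r S T (u : over_hom S T) : over_comp u (over_id T) = u.
Proof. exact: over_hom_eq. Qed.

Fact over_compA S T U V (u : over_hom S T) (v : over_hom T U)
    (w : over_hom U V) :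
  over_comp u (over_comp v w) = over_comp (over_comp u v) w.
Proof. exact: over_hom_eq. Qed.

Definition RingsOver : category :=
  Category over_comp1 over_comp1r over_compA.
End RingsOver.

Definition pushfwd (A B : comPzRingType) (f : {rmorphism B -> A})
  (M : lmodType A) : Type := M.

Section Pushfwd.
Variables (A B : comPzRingType) (f : {rmorphism B -> A}) (M : lmodType A).
Local Notation fM := (pushfwd f M).

HB.instance Definition _ := GRing.Zmodule.copy fM M.

Definition pushfwd_scale (b : B) (m : fM) : fM := f b *: (m : M).

Fact pushfwd_scaleA a b m :
  pushfwd_scale a (pushfwd_scale b m) = pushfwd_scale (a * b) m.
Proof. by rewrite /pushfwd_scale scalerA rmorphM. Qed.

Fact pushfwd_scale1 : left_id 1 pushfwd_scale.
Proof. by move=> m; rewrite /pushfwd_scale rmorph1 scale1r. Qed.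

Fact pushfwd_scaleDr : right_distributive pushfwd_scale +%R.
Proof. by move=> b m n; rewrite /pushfwd_scale scalerDr. Qed.

Fact pushfwd_scaleDl m : {morph pushfwd_scale^~ m : a b / a + b}.
Proof. by move=> a b; rewrite /pushfwd_scale rmorphD scalerDl. Qed.

HB.instance Definition _ := GRing.Zmodule_isLmodule.Build B fM
  pushfwd_scaleA pushfwd_scale1 pushfwd_scaleDr pushfwd_scaleDl.
End Pushfwd.

Section Kernel.
Variables (A B : comPzRingType) (f : {rmorphism B -> A}).

(* [B^o] is B as a module over itself, so [ker_of] is a B-submodule of B. *)
Definition ker_pred : {pred B^o} := fun b => f b == 0.

Fact ker_pred_submod : subsemimod_closed ker_pred.
Proof.
split; first split.
- by rewrite unfold_in /= rmorph0.
- move=> x y; rewrite !unfold_in /= => /eqP fx /eqP fy.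
  by rewrite rmorphD fx fy addr0.
- move=> b x; rewrite !unfold_in /= => /eqP fx.
  by rewrite /GRing.scale /= rmorphM fx mulr0.
Qed.

HB.instance Definition _ := GRing.isSubmodClosed.Build B B^o ker_pred
  ker_pred_submod.

Record ker_of := Ker { ker_val : B^o; _ : ker_val \in ker_pred }.

HB.instance Definition _ := [isSub for ker_val].
HB.instance Definition _ := [Choice of ker_of by <:].
HB.instance Definition _ := [SubChoice_isSubLmodule of ker_of by <:].
End Kernel.

(* The inverse of a bijective linear map is linear, so [ext_iso_bij] makes
   [ext_iso] an isomorphism of B-modules. [ext_sqz] is stated on generators of
   the ideal (ker f)^2. *)
Record sqz_ext (A : comPzRingType) (M : lmodType A) := SqzExt {
  ext_ring :> ring_over A;
  ext_surj : forall a, exists b, proj ext_ring b = a;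
  ext_sqz : forall x y, proj ext_ring x = 0 -> proj ext_ring y = 0 -> x * y = 0;
  ext_iso : {linear pushfwd (proj ext_ring) M -> ker_of (proj ext_ring)};
  ext_iso_bij : bijective ext_iso }.

Definition ext_alpha (A : comPzRingType) (M : lmodType A) (E : sqz_ext M)
  (m : M) : E := val (ext_iso E m).

Record ext_hom (A : comPzRingType) (M : lmodType A) (E F : sqz_ext M) :=
  ExtHom {
    ext_fun :> over_hom E F;
    ext_homE : forall m : M, ext_fun (ext_alpha E m) = ext_alpha F m }.

Section ExalCategory.
Variables (A : comPzRingType) (M : lmodType A).
Implicit Types E F G H : sqz_ext M.

Lemma ext_hom_eq E F (u v : ext_hom E F) :
  ext_fun u = ext_fun v -> u = v.
Proof.
case: u v => [u hu] [v hv] /= uv; subst v.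
by rewrite (Prop_irrelevance hu hv).
Qed.

Definition ext_id E : ext_hom E E :=
  @ExtHom A M E E (over_id E) (fun=> erefl).

Fact ext_comp_subproof E F G (u : ext_hom E F) (v : ext_hom F G) (m : M) :
  over_comp u v (ext_alpha E m) = ext_alpha G m.
Proof. by rewrite /= !ext_homE. Qed.

Definition ext_comp E F G (u : ext_hom E F) (v : ext_hom F G) : ext_hom E G :=
  ExtHom (ext_comp_subproof u v).

Fact ext_comp1 E F (u : ext_hom E F) : ext_comp (ext_id E) u = u.
Proof. by apply: ext_hom_eq; apply: over_comp1. Qed.

Fact ext_comp1r E F (u : ext_hom E F) : ext_comp u (ext_id F) = u.
Proof. by apply: ext_hom_eq; apply: over_comp1r. Qed.

Fact ext_compA E F G H (u : ext_hom E F) (v : ext_hom F G) (w : ext_hom G H) :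
  ext_comp u (ext_comp v w) = ext_comp (ext_comp u v) w.
Proof. by apply: ext_hom_eq; apply: over_compA. Qed.
End ExalCategory.

Definition Exal (A : comPzRingType) (M : lmodType A) : category :=
  Category (@ext_comp1 A M) (@ext_comp1r A M) (@ext_compA A M).

Definition triv_ext (A : comPzRingType) (M : lmodType A) : Type :=
  (A * M)%type.

Section TrivExt.
Variables (A : comPzRingType) (M : lmodType A).
Local Notation AM := (triv_ext M).

HB.instance Definition _ := GRing.Zmodule.copy AM (A * M)%type.

Definition triv_one : AM := (1, 0).
Definition triv_mul (x y : AM) : AM :=
  (x.1 * y.1, x.1 *: y.2 + y.1 *: x.2).

Fact triv_mulA : associative triv_mul.
Proof.
move=> [a x] [b y] [c z]; rewrite /triv_mul /= mulrA; congr (_, _).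
by rewrite !scalerDr !scalerA addrA [c * a]mulrC [c * b]mulrC.
Qed.

Fact triv_mulC : commutative triv_mul.
Proof. by move=> [a x] [b y]; rewrite /triv_mul /= mulrC addrC. Qed.

Fact triv_mul1 : left_id triv_one triv_mul.
Proof.
by move=> [a x]; rewrite /triv_mul /= mul1r scale1r scaler0 addr0.
Qed.

Fact triv_mulDl : left_distributive triv_mul +%R.
Proof.
move=> [a x] [b y] [c z]; rewrite /triv_mul /=; congr (_, _).
  by rewrite mulrDl.
by rewrite /= scalerDl scalerDr addrACA.
Qed.

HB.instance Definition _ := GRing.Zmodule_isComPzRing.Build AM
  triv_mulA triv_mulC triv_mul1 triv_mulDl.

Definition triv_proj (x : AM) : A := x.1.

Fact triv_proj_zmod : zmod_morphism triv_proj.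
Proof. by []. Qed.

Fact triv_proj_monoid : monoid_morphism triv_proj.
Proof. by []. Qed.

HB.instance Definition _ :=
  GRing.isZmodMorphism.Build AM A triv_proj triv_proj_zmod.
HB.instance Definition _ :=
  GRing.isMonoidMorphism.Build AM A triv_proj triv_proj_monoid.

Definition triv_over : ring_over A := @RingOver A AM triv_proj.
End TrivExt.

Section FibreProduct.
Variables (A B C : comPzRingType).
Variables (f : {rmorphism B -> A}) (g : {rmorphism C -> A}).

Definition fprod_pred : {pred (B * C)%type} := fun x => f x.1 == g x.2.

Fact fprod_pred_subring : subring_closed fprod_pred.
Proof.
split.
- by rewrite unfold_in /= !rmorph1.
- move=> x y; rewrite !unfold_in /= => /eqP hx /eqP hy.
  by rewrite !rmorphB hx hy.
- move=> x y; rewrite !unfold_in /= => /eqP hx /eqP hy.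
  by rewrite !rmorphM hx hy.
Qed.

HB.instance Definition _ := GRing.isSubringClosed.Build (B * C)%type fprod_pred
  fprod_pred_subring.

Record fprod := FProd { fprod_val : (B * C)%type; _ : fprod_val \in fprod_pred }.

HB.instance Definition _ := [isSub for fprod_val].
HB.instance Definition _ := [Choice of fprod by <:].
HB.instance Definition _ := GRing.SubChoice_isSubComPzRing.Build _ _ fprod
  (GRing.subringClosedP _).

Definition fprod_proj (x : fprod) : A := f (val x).1.

Fact fprod_proj_zmod : zmod_morphism fprod_proj.
Proof. by move=> x y; rewrite /fprod_proj -rmorphB. Qed.

Fact fprod_proj_monoid : monoid_morphism fprod_proj.
Proof.
split; first exact: rmorph1 f.
by move=> x y; rewrite /fprod_proj -rmorphM.
Qed.

HB.instance Definition _ :=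
  GRing.isZmodMorphism.Build fprod A fprod_proj fprod_proj_zmod.
HB.instance Definition _ :=
  GRing.isMonoidMorphism.Build fprod A fprod_proj fprod_proj_monoid.
End FibreProduct.

Definition over_prod (A : comPzRingType) (S T : ring_over A) : ring_over A :=
  @RingOver A (fprod (proj S) (proj T)) (@fprod_proj _ _ _ (proj S) (proj T)).

Section ActionPoint.
Variables (A : comPzRingType) (M : lmodType A) (S : ring_over A).

Fact act_point_subproof (m : M) (b : S) :
  ((proj S b, m) : triv_ext M, b) \in fprod_pred (proj (triv_over M)) (proj S).
Proof. by rewrite unfold_in. Qed.

Definition act_point (m : M) (b : S) : over_prod (triv_over M) S :=
  FProd (act_point_subproof m b).
End ActionPoint.

Record torsor (A : comPzRingType) (M : lmodType A) := Torsor {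
  tors_ring :> ring_over A;
  tors_surj : forall a, exists b, proj tors_ring b = a;
  tors_tau : over_hom (over_prod (triv_over M) tors_ring) tors_ring;
  tors_tau0 : forall b, tors_tau (act_point 0 b) = b;
  tors_transitive : forall b1 b2, proj tors_ring b1 = proj tors_ring b2 ->
    exists! m : M, tors_tau (act_point m b2) = b1 }.

Definition tors_act (A : comPzRingType) (M : lmodType A) (T : torsor M)
  (m : M) (b : T) : T := tors_tau T (act_point m b).

Record tors_hom (A : comPzRingType) (M : lmodType A) (T U : torsor M) :=
  TorsHom {
    tors_fun :> over_hom T U;
    tors_homE : forall (m : M) (b : T),
      tors_fun (tors_act m b) = tors_act m (tors_fun b) }.

Section TorsCategory.
Variables (A : comPzRingType) (M : lmodType A).
Implicit Types T U V W : torsor M.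

Lemma tors_hom_eq T U (u v : tors_hom T U) :
  tors_fun u = tors_fun v -> u = v.
Proof.
case: u v => [u hu] [v hv] /= uv; subst v.
by rewrite (Prop_irrelevance hu hv).
Qed.

Definition tors_id T : tors_hom T T :=
  @TorsHom A M T T (over_id T) (fun _ _ => erefl).

Fact tors_comp_subproof T U V (u : tors_hom T U) (v : tors_hom U V)
    (m : M) (b : T) :
  over_comp u v (tors_act m b) = tors_act m (over_comp u v b).
Proof. by rewrite /= !tors_homE. Qed.

Definition tors_comp T U V (u : tors_hom T U) (v : tors_hom U V) :
    tors_hom T V :=
  TorsHom (tors_comp_subproof u v).

Fact tors_comp1 T U (u : tors_hom T U) : tors_comp (tors_id T) u = u.
Proof. by apply: tors_hom_eq; apply: over_comp1. Qed.

Fact tors_comp1r T U (u : tors_hom T U) : tors_comp u (tors_id U) = u.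
Proof. by apply: tors_hom_eq; apply: over_comp1r. Qed.

Fact tors_compA T U V W (u : tors_hom T U) (v : tors_hom U V)
    (w : tors_hom V W) :
  tors_comp u (tors_comp v w) = tors_comp (tors_comp u v) w.
Proof. by apply: tors_hom_eq; apply: over_compA. Qed.
End TorsCategory.

Definition Tors (A : comPzRingType) (M : lmodType A) : category :=
  Category (@tors_comp1 A M) (@tors_comp1r A M) (@tors_compA A M).

Section PsiObj.
Variables (A : comPzRingType) (M : lmodType A) (E : sqz_ext M).
Local Notation f := (proj E).
Local Notation alpha := (ext_alpha E).

Lemma ext_alphaD : {morph alpha : m n / m + n}.
Proof.
by move=> m n; rewrite /ext_alpha (raddfD (ext_iso E) m n) raddfD.
Qed.

Lemma ext_alpha0 : alpha 0 = 0.
Proof. by apply: (addrI (alpha 0)); rewrite -ext_alphaD !addr0. Qed.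

Lemma ext_alphaB : {morph alpha : m n / m - n}.
Proof.
by move=> m n; apply: (addIr (alpha n)); rewrite -ext_alphaD !subrK.
Qed.

Lemma ext_alphaZ b m : alpha (f b *: m) = b * alpha m.
Proof.
rewrite /ext_alpha.
by have /(congr1 val) := linearZ_LR (ext_iso E) b m.
Qed.

Lemma proj_ext_alpha m : f (alpha m) = 0.
Proof. by apply/eqP; exact: valP (ext_iso E m). Qed.

Definition psi_fun (x : over_prod (triv_over M) E) : E :=
  alpha (val x).1.2 + (val x).2.

Fact psi_fun_zmod : zmod_morphism psi_fun.
Proof.
move=> x y; rewrite /psi_fun /=.
by rewrite ext_alphaB opprD addrACA.
Qed.

Fact psi_fun_monoid : monoid_morphism psi_fun.
Proof.
split; first by rewrite /psi_fun /= ext_alpha0 add0r.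
move=> x y; rewrite /psi_fun.
have hx : (val x).1.1 = f (val x).2 := eqP (valP x).
have hy : (val y).1.1 = f (val y).2 := eqP (valP y).
have -> : (val (x * y)).1.2 =
  (val x).1.1 *: (val y).1.2 + (val y).1.1 *: (val x).1.2 by [].
have -> : (val (x * y)).2 = (val x).2 * (val y).2 by [].
rewrite hx hy ext_alphaD !ext_alphaZ mulrDl !mulrDr.
rewrite [alpha _ * alpha _]ext_sqz ?proj_ext_alpha // add0r.
by rewrite [alpha _ * _]mulrC addrA [_ * alpha (val y).1.2 + _]addrC.
Qed.

HB.instance Definition _ :=
  GRing.isZmodMorphism.Build (over_prod (triv_over M) E) E psi_fun
    psi_fun_zmod.
HB.instance Definition _ :=
  GRing.isMonoidMorphism.Build (over_prod (triv_over M) E) E psi_fun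
    psi_fun_monoid.

Fact psi_over x : f (psi_fun x) = proj (over_prod (triv_over M) E) x.
Proof.
rewrite /psi_fun rmorphD proj_ext_alpha add0r.
by case: x => x /= /eqP.
Qed.

Definition psi_tau : over_hom (over_prod (triv_over M) E) E :=
  @OverHom A (over_prod (triv_over M) E) E psi_fun psi_over.

Lemma psi_tauE (m : M) (b : E) : psi_tau (act_point m b) = alpha m + b.
Proof. by []. Qed.

Fact psi_tau0 b : psi_tau (act_point 0 b) = b.
Proof. by rewrite psi_tauE ext_alpha0 add0r. Qed.

Fact psi_transitive b1 b2 : f b1 = f b2 ->
  exists! m : M, psi_tau (act_point m b2) = b1.
Proof.
move=> fb; have kb : (b1 - b2 : (E : comPzRingType)^o) \in ker_pred f.
  by rewrite unfold_in rmorphB fb subrr.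
have [beta alphaK betaK] := ext_iso_bij E.
exists (beta (Ker kb)); split.
  by rewrite psi_tauE /ext_alpha betaK /= subrK.
move=> m; rewrite psi_tauE => mb.
have {mb} : ext_iso E m = Ker kb.
  by apply: val_inj; rewrite /= -mb addrK.
by move <-; rewrite alphaK.
Qed.

Definition Psi_obj : torsor M :=
  @Torsor A M E (@ext_surj A M E) psi_tau psi_tau0 psi_transitive.
End PsiObj.

Section PsiFunctor.
Variables (A : comPzRingType) (M : lmodType A).

Fact Psi_hom_subproof (E F : sqz_ext M) (u : ext_hom E F) (m : M)
    (b : Psi_obj E) :
  (u : over_hom (Psi_obj E) (Psi_obj F)) (tors_act m b) =
  tors_act m ((u : over_hom (Psi_obj E) (Psi_obj F)) b).
Proof. by rewrite /tors_act /= /psi_fun rmorphD /= ext_homE. Qed.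

Definition Psi_hom (E F : sqz_ext M) (u : ext_hom E F) :
    tors_hom (Psi_obj E) (Psi_obj F) :=
  TorsHom (Psi_hom_subproof u).

Fact Psi_hom_id (E : Exal M) : Psi_hom (idc E) = idc (Psi_obj E : Tors M).
Proof. exact: tors_hom_eq. Qed.

Fact Psi_hom_comp (E F G : Exal M) (u : hom E F) (v : hom F G) :
  Psi_hom (compc u v) =
  compc (Psi_hom u : hom (Psi_obj E : Tors M) (Psi_obj F)) (Psi_hom v).
Proof. exact: tors_hom_eq. Qed.

Definition Psi : functor (Exal M) (Tors M) :=
  @Functor (Exal M) (Tors M) (@Psi_obj A M) Psi_hom Psi_hom_id Psi_hom_comp.
End PsiFunctor.
Arguments Psi {A} M.

(* Main.v *)
Require Import Defs.
From mathcomp Require Import all_boot all_algebra.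
From HB Require Import structures.
From mathcomp Require Import boolp.

(** An inverse functor to [Psi] can be written down explicitly: it keeps the
    ring over A and the underlying homomorphisms, and recovers the
    identification of M with the kernel from the action on zero,
    alpha(m) = tau(m, 0).

    Everything rests on tau being a ring homomorphism, because the pairs
    (m, b) add and multiply as elements of the fibre product.  In it,
    (m, b) = (m, 0) + (0, b), so tau(m, b) = alpha(m) + b
    ([tors_act_trans]): the whole action is translation by alpha.  Likewise
    (0, b) (m, 0) = (f(b) m, 0), so alpha is linear over B
    ([tors_alphaZ]), and (m, 0) (n, 0) = 0, so products of values of alpha
    vanish ([tors_alpha_mul]).  Simple transitivity on the fibre of 0 says that
    alpha is a bijection from M onto the kernel of f ([tors_alpha_onto],
    [tors_alpha_inj]), and hence the kernel has square zero.

    Both composites with [Psi] fix the underlying ring over A, and by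
    [tors_act_trans] they fix the extra structure too; identity maps are
    therefore the components of the two natural isomorphisms. *)

Import GRing.Theory.
Local Open Scope ring_scope.

Section TorsorExtension.
Set Implicit Arguments.
Unset Strict Implicit.
Variables (A : comPzRingType) (M : lmodType A).

Section TorsorKernel.
Variable T : torsor M.
Local Notation f := (proj T).

(** The action of M on zero, as a map from M to the total ring. *)
Definition tors_alpha (m : M) : T := tors_act m 0.

Lemma act_pointD (m n : M) (b c : T) :
  act_point (m + n) (b + c) = act_point m b + act_point n c.
Proof.
apply: val_inj; rewrite /=.
by congr (_, _, _); rewrite rmorphD.
Qed.

Lemma act_pointM (m n : M) (b c : T) :
  act_point (f b *: n + f c *: m) (b * c) = act_point m b * act_point n c.
Proof.
apply: val_inj; rewrite /=.
by congr (_, _, _); rewrite rmorphM.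
Qed.

Lemma tors_actD (m n : M) (b c : T) :
  tors_act (m + n) (b + c) = tors_act m b + tors_act n c.
Proof. by rewrite /tors_act act_pointD rmorphD. Qed.

Lemma tors_actM (m n : M) (b c : T) :
  tors_act (f b *: n + f c *: m) (b * c) = tors_act m b * tors_act n c.
Proof. by rewrite /tors_act act_pointM rmorphM. Qed.

Lemma tors_act0 (b : T) : tors_act 0 b = b.
Proof. exact: tors_tau0. Qed.

Lemma proj_tors_act (m : M) (b : T) : f (tors_act m b) = f b.
Proof. by rewrite /tors_act over_homE. Qed.

(** The action is translation by [tors_alpha]. *)
Lemma tors_act_trans (m : M) (b : T) : tors_act m b = tors_alpha m + b.
Proof. by rewrite -{2}[b]tors_act0 -tors_actD addr0 add0r. Qed.

Lemma tors_alphaD : {morph tors_alpha : m n / m + n}.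
Proof. by move=> m n; rewrite /tors_alpha -tors_actD addr0. Qed.

Lemma tors_alphaZ (b : T) (m : M) : tors_alpha (f b *: m) = b * tors_alpha m.
Proof.
by rewrite -{2}[b]tors_act0 -tors_actM rmorph0 scale0r addr0 mulr0.
Qed.

Lemma tors_alpha_mul (m n : M) : tors_alpha m * tors_alpha n = 0.
Proof. by rewrite -tors_actM rmorph0 !scale0r addr0 mulr0 tors_act0. Qed.

Lemma proj_tors_alpha (m : M) : f (tors_alpha m) = 0.
Proof. by rewrite proj_tors_act rmorph0. Qed.

Lemma tors_alpha_onto (x : T) : f x = 0 -> exists m, tors_alpha m = x.
Proof.
move=> fx; have /tors_transitive[m [mx _]] : f x = f 0 by rewrite fx rmorph0.
by exists m.
Qed.

Lemma tors_alpha_inj : injective tors_alpha.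
Proof.
move=> m n mn.
have /tors_transitive[k [_ k_uniq]] : f (tors_alpha n) = f 0.
  by rewrite proj_tors_alpha rmorph0.
by rewrite -(k_uniq m mn) -(k_uniq n erefl).
Qed.

Lemma tors_sqz (x y : T) : f x = 0 -> f y = 0 -> x * y = 0.
Proof.
by move=> /tors_alpha_onto[m <-] /tors_alpha_onto[n <-]; apply: tors_alpha_mul.
Qed.

Lemma tors_alpha_ker (m : M) :
  (tors_alpha m : (T : comPzRingType)^o) \in ker_pred f.
Proof. by rewrite unfold_in proj_tors_alpha. Qed.

(** [tors_alpha] with values in the kernel of the projection. *)
Definition tors_iso (m : pushfwd f M) : ker_of f := Ker (tors_alpha_ker m).

Lemma tors_iso_zmod : zmod_morphism tors_iso.
Proof.
move=> m n; apply: val_inj => /=.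
by apply: (addIr (tors_alpha n)); rewrite -tors_alphaD !subrK.
Qed.

Lemma tors_iso_scalable : scalable tors_iso.
Proof. by move=> b m; apply: val_inj; apply: tors_alphaZ. Qed.

HB.instance Definition _ :=
  GRing.isZmodMorphism.Build (pushfwd f M) (ker_of f) tors_iso tors_iso_zmod.
HB.instance Definition _ :=
  GRing.isScalable.Build T (pushfwd f M) (ker_of f) *:%R tors_iso
    tors_iso_scalable.

Lemma tors_iso_bij : bijective tors_iso.
Proof.
have onto (x : ker_of f) : exists m, tors_alpha m = val x.
  by apply: tors_alpha_onto; apply/eqP; apply: (valP x).
exists (fun x => projT1 (cid (onto x))) => [m|x].
  by apply: tors_alpha_inj; case: cid.
by apply: val_inj; case: cid.
Qed.

(** The torsor T as a square-zero extension: the same ring over A, with its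
    kernel identified with M by [tors_iso]. *)
Definition tors_ext : sqz_ext M :=
  @SqzExt A M T (@tors_surj A M T) tors_sqz tors_iso tors_iso_bij.

Lemma ext_alpha_tors (m : M) : ext_alpha tors_ext m = tors_alpha m.
Proof. by []. Qed.

End TorsorKernel.

Lemma tors_ext_hom_subproof (T U : torsor M) (u : tors_hom T U) (m : M) :
  (u : over_hom (tors_ext T) (tors_ext U)) (ext_alpha (tors_ext T) m)
  = ext_alpha (tors_ext U) m.
Proof. by rewrite !ext_alpha_tors /tors_alpha tors_homE rmorph0. Qed.

(** A morphism of torsors, regarded as a morphism of extensions. *)
Definition tors_ext_hom (T U : torsor M) (u : tors_hom T U) :
  ext_hom (tors_ext T) (tors_ext U) := ExtHom (tors_ext_hom_subproof u).

Lemma tors_ext_hom_id (T : Tors M) :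
  tors_ext_hom (idc T) = idc (tors_ext T : Exal M).
Proof. exact: ext_hom_eq. Qed.

Lemma tors_ext_hom_comp (T U V : Tors M)
    (u : Defs.hom T U) (v : Defs.hom U V) :
  tors_ext_hom (compc u v) =
  compc (tors_ext_hom u : Defs.hom (tors_ext T : Exal M) (tors_ext U))
    (tors_ext_hom v).
Proof. exact: ext_hom_eq. Qed.

(** The functor from M-torsors to square-zero extensions of A by M. *)
Definition Tors_to_Exal : functor (Tors M) (Exal M) :=
  @Functor (Tors M) (Exal M) tors_ext tors_ext_hom
    tors_ext_hom_id tors_ext_hom_comp.

Lemma tors_alpha_Psi (E : sqz_ext M) (m : M) :
  tors_alpha (Psi_obj E) m = ext_alpha E m.
Proof. exact: addr0. Qed.

(** The identity of the underlying ring, as a morphism of extensions from the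
    extension of the torsor of E to E. *)
Definition ext_counit (E : sqz_ext M) : ext_hom (tors_ext (Psi_obj E)) E :=
  @ExtHom A M (tors_ext (Psi_obj E)) E (over_id E) (tors_alpha_Psi E).

(** The same identity map, in the other direction. *)
Definition ext_counit_inv (E : sqz_ext M) : ext_hom E (tors_ext (Psi_obj E)) :=
  @ExtHom A M E (tors_ext (Psi_obj E)) (over_id E)
    (fun m => esym (tors_alpha_Psi E m)).

Lemma Psi_Tors_to_Exal : nat_iso (comp_functor (Psi M) Tors_to_Exal)
  (id_functor (Exal M)).
Proof.
exists ext_counit ext_counit_inv => [E|E|E F u];
  by apply: ext_hom_eq; apply: over_hom_eq.
Qed.

Lemma tors_act_Psi (T : torsor M) (m : M) (b : T) :
  tors_act (T := Psi_obj (tors_ext T)) m b = tors_act m b.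
Proof. by rewrite [RHS]tors_act_trans. Qed.

(** The identity of the underlying ring, as a morphism of torsors from the
    torsor of the extension of T to T. *)
Definition tors_counit (T : torsor M) : tors_hom (Psi_obj (tors_ext T)) T :=
  @TorsHom A M (Psi_obj (tors_ext T)) T (over_id T)
    (@tors_act_Psi T).

(** The same identity map, in the other direction. *)
Definition tors_counit_inv (T : torsor M) :
    tors_hom T (Psi_obj (tors_ext T)) :=
  @TorsHom A M T (Psi_obj (tors_ext T)) (over_id T)
    (fun m b => esym (tors_act_Psi m b)).

Lemma Tors_to_Exal_Psi : nat_iso (comp_functor Tors_to_Exal (Psi M))
  (id_functor (Tors M)).
Proof.
exists tors_counit tors_counit_inv => [T|T|T U u];
  by apply: tors_hom_eq; apply: over_hom_eq.
Qed.

End TorsorExtension.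

Theorem theorem2p14 (A : comPzRingType) (M : lmodType A) :
  is_equivalence (Psi M).
Proof.
exists (Tors_to_Exal M); split; constructor.
- exact: Psi_Tors_to_Exal.
- exact: Tors_to_Exal_Psi.
Qed.
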